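(* Let $G$ be a finite simple connected graph on $n$ vertices such that there are no three vertices of $G$ that are pairwise at distance $2$. Suppose there exists a vertex $v \in V(G)$ whose neighbourhood $N_G(v)$ is covered by at most two cliques, i.e. $N_G(v)=A\cup B$ where each of $A$ and $B$ (possibly empty) induces a complete subgraph. Then the number of unordered pairs $\{x,y\}$ of vertices of $G$ with $d_G(x,y)=2$ is at most $(n^2-1)/4+1$.
   Context: $d_G(x,y)$ denotes the length of a shortest path between $x$ and $y$ in $G$. A clique is a set of pairwise adjacent vertices. *)

(* Defs.v *)
From mathcomp Require Import all_boot.

Set Implicit Arguments.
Unset Strict Implicit.
Unset Printing Implicit Defensive.

Section Graph.
Variables (T : finType) (e : rel T).

Definition simple_graph : Prop := symmetric e /\ irreflexive e.

Definition connected_graph : Prop := forall x y : T, connect e x y.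

Definition neighbourhood (v : T) : {set T} := [set w | e v w].

Definition clique (A : {set T}) : Prop :=
  {in A &, forall x y : T, x != y -> e x y}.

Definition has_path (k : nat) (x y : T) : bool :=
  [exists p : k.-tuple T, [&& path e x p, last x p == y & uniq (x :: p)]].

(* Paths have fewer than #|T| edges, so this is the least k such that
   has_path k x y; the value is #|T| when there is no path from x to y. *)
Definition dist (x y : T) : nat :=
  find (fun k => has_path k x y) (iota 0 #|T|).

Definition dist2_pairs : {set {set T}} :=
  [set S : {set T} |
    [exists x, exists y, (S == [set x; y]) && (dist x y == 2)]].

End Graph.

(* Main.v *)
(** The pairs at distance [2] are the edges of a graph which, by hypothesis, has
    no triangle, so Mantel's theorem bounds their number by [n^2 / 4], which is
    less than [(n^2 - 1) / 4 + 1].  For Mantel's theorem, the neighbourhood of a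
    vertex of maximal degree [d] is independent, so every edge has an end among
    the [n - d] remaining vertices; there are at most [d (n - d)] edges. *)
Require Import Defs.
From mathcomp Require Import all_boot all_order all_algebra.
From mathcomp Require Import lra.

Set Implicit Arguments.
Unset Strict Implicit.
Unset Printing Implicit Defensive.

Lemma mantel (T : finType) (r : rel T) :
    symmetric r -> (forall x y z, r x y -> r y z -> ~~ r x z) ->
  4 * #|[set S : {set T} |
          [exists x, exists y, (S == [set x; y]) && r x y]]| <= #|T| ^ 2.
Proof.
move=> r_sym r_free; set E := [set S | _].
(* A vertex of maximal degree exists only if [T] is nonempty, so the empty type is settled apart. *)
have [v0 _ | T0] := pickP (mem T); last first.
  rewrite (_ : E = set0) ?cards0 //; apply/setP=> S; rewrite !inE.
  by apply/existsP=> -[x _]; have := T0 x.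
pose N x := [set y | r x y].
have [v _ v_max] := @arg_maxnP _ v0 xpredT (fun x => #|N x|) isT.
(* Edges oriented to start outside [N v]. An edge with both ends outside occurs twice, which is
   harmless for an upper bound. *)
pose D := [set p : T * T | (p.1 \notin N v) && (p.2 \in N p.1)].
have sED : E \subset [set [set p.1; p.2] | p in D].
  apply/subsetP=> S; rewrite inE => /existsP[x /existsP[y /andP[/eqP-> rxy]]].
  have [xv | xNv] := boolP (x \in N v); last first.
    by apply/imsetP; exists (x, y); rewrite // !inE rxy andbT; rewrite inE in xNv.
  (* Here [x] is in [N v], so [y] is not: otherwise [v], [x], [y] would form a triangle. *)
  apply/imsetP; exists (y, x); last by rewrite setUC.
  by rewrite !inE /= [r y x]r_sym rxy (r_free v x y) //; rewrite inE in xv.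
have cD : #|D| <= #|~: N v| * #|N v|.
  rewrite -sum1_card (eq_bigl _ _ (fun p => in_set _ p)) /=.
  rewrite -(pair_big_dep (fun x => x \notin N v) (fun x y => y \in N x)
              (fun _ _ => 1)) /=.
  rewrite -sum_nat_const (eq_bigl (mem (~: N v))) => [|x]; last by rewrite !inE.
  by apply: leq_sum => x _; rewrite sum1_card; apply: v_max.
(* AM-GM with [#|N v|] and [#|~: N v|], whose sum is [#|T|]. *)
rewrite -(cardsC (N v)) (leq_trans _ (nat_AGM2 _ _)) // leq_mul2l /=.
rewrite mulnC (leq_trans _ cD) // (leq_trans (subset_leq_card sED)) //.
exact: leq_imset_card.
Qed.

Lemma has_path_rev (T : finType) (e : rel T) k x y :
  symmetric e -> has_path e k x y -> has_path e k y x.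
Proof.
move=> e_sym /existsP[p /and3P[e_p /eqP<- u_p]].
(* The tuple of a path omits its starting vertex, so the reversed path drops [y] and gains [x]. *)
have sz_q : size (rev (belast x p)) == k by rewrite size_rev size_belast size_tuple.
apply/existsP; exists (Tuple sz_q); apply/and3P; split.
- by rewrite /= rev_path (eq_path (e' := e)) // => a b; exact: e_sym.
- by rewrite /=; case: (tval p) => //= a s; rewrite rev_cons last_rcons.
- by rewrite -rev_rcons -lastI rev_uniq.
Qed.

Lemma dist_sym (T : finType) (e : rel T) x y :
  symmetric e -> dist e x y = dist e y x.
Proof. by move=> e_sym; apply: eq_find => k; apply/idP/idP; exact: has_path_rev. Qed.

Import Order.TTheory GRing.Theory Num.Theory.
Local Open Scope ring_scope.

Theorem theorem1p1 (T : finType) (e : rel T) (n : nat)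
    (card_T : #|T| = n)
    (simple_e : simple_graph e)
    (connected_e : connected_graph e)
    (no_dist2_triple : ~ (exists x y z : T,
       [/\ dist e x y = 2%N, dist e y z = 2%N & dist e x z = 2%N]))
    (two_cliques : exists (v : T) (A B : {set T}),
       [/\ neighbourhood e v = A :|: B, clique e A & clique e B]) :
  (#|dist2_pairs e|%:R : rat) <= (n%:R ^+ 2 - 1) / 4 + 1.
Proof.
have [e_sym _] := simple_e.
have : (4 * #|dist2_pairs e| <= n ^ 2)%N.
  rewrite -card_T; apply: (@mantel T (fun x y => dist e x y == 2%N)).
    by move=> x y; rewrite dist_sym.
  move=> x y z /eqP dxy /eqP dyz; apply/eqP=> dxz.
  by apply: no_dist2_triple; exists x, y, z.
(* Over [rat] the goal is linear in [n%:R ^+ 2], with slack 3/4. *)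
by rewrite -(ler_nat rat) natrM natrX; lra.
Qed.
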